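(* Consider a Dynamic Task Assignment Problem (DTAP) with a limited time horizon $\tau_{\max}$ and constant arrival rate of cases $\lambda$. Let $t_{\max}$ be the sequence number of the last decision taken before $\tau_{\max}$. Assume the reward function $r_t$ defined in the context and a discount factor $\gamma=1$. Let $C_{\max}=|C^{a}_{\tau_{\max}}|+|C^{b}_{\tau_{\max}}|+|C^{c}_{\tau_{\max}}|$ be the total number of cases that entered the system, and let $W$ be the average cycle time of cases. Then the sum of rewards over an episode, $R_{t_{\max}}$, is equal to the negative product of $C_{\max}$ and $W$: $$R_{t_{\max}}=\sum_{t=0}^{t_{\max}} r_t=-\,C_{\max}\,W .$$
   Context: **DTAP instance.** A DTAP is a tuple $(M,L,f_{\mathrm{comp}},G,f_{\mathrm{trans}},P,V,\lambda,\tau_{\max})$: $M$ is the set of resources; $L$ is the set of activity labels, containing at least a Start and an End activity; $G$ is a set of pairs $(l,m)$, $l\in L$, $m\in M$, indicating which resources $m$ can be assigned to cases whose current activity is $l$; $f_{\mathrm{comp}}:G\to\mathbb{R}^{+}\times\mathbb{R}^{+}$ gives the parameters (mean $\mu_{(l,m)}$ and spread $\sigma_{(l,m)}$) of a Gaussian random variable, the absolute value of whose sample is the completion time of the assignment; $f_{\mathrm{trans}}$ associates with each label $l$ a probability for every label in $L$, from which the next activity of a case is sampled when $l$ is completed (at least one activity has nonzero probability of being followed by End); $P\in\mathbb{N}^{K}$ is an hourly calendar of expected numbers of active resources; $V\in\mathbb{N}^{|M|}$ is a vector of weights used to sample which resources enter or exit the system every hour; $\lambda\in\mathbb{R}^{+}$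 is the arrival rate of cases; $\tau_{\max}\in\mathbb{R}^{+}$ is the time horizon. **State.** At simulated time $\tau$ the state is $(M^{a}_\tau,M^{b}_\tau,C^{a}_\tau,C^{b}_\tau,B_\tau,t)$: $M^a_\tau,M^b_\tau\subseteq M$ are the sets of active (available for assignment) and busy resources; $C^{a}_\tau$ and $C^{b}_\tau$ are the multisets of active and busy cases, each characterized by its current activity label; $B_\tau$ is the set of assignments (resource, case, completion time); $t$ is the current decision step, i.e. the number of individual assignments of a resource to a case made until $\tau$. $C^{c}_\tau$ denotes the completed cases at time $\tau$. **Transitions.** The state changes through the following transitions. - *Case Arrival*: a new case with label Start is added to $C^a$; arrivals happen at rate $\lambda$. - *Plan Activity*: if there are possible assignments according to $G$, the agent takes a decision, selecting one resource $m$ and one case $c$; $m$ moves from $M^a$ to $M^b$ and $c$ moves from $C^a$ to $C^b$. - *Start Activity*: after the agent's selection, the completion time is sampled and the assignment is added to $B$; simulated time does not progress. - *Complete Activity*: when the completion time of an assignment has elapsed, the resource is removed from $M^b$ and either placed in $M^a$ or removed from the system; a new label for the case is sampled from $f_{\mathrm{trans}}$, and the case is either moved to $C^a$ or, if End is reached, removed from the system. - *Schedule Resources*: every time unit (hour) the active resources are adjusted based on $P$ and $V$. - *Complete Case*: if the next activity of a case is End, the case is removed from $C^b$. **Reward function.** Let $t\in\mathbb{N}$ be the sequence number of a decision step. Let $\mathrm{T}_t=\{\tau_0,\dots,\tau_n\}$ be the multiset of all times a state transition happened between decision step $t-1$ and decision step $t$, or since the start of the simulation if $t=0$, and let $C_t=\{c_0,\dots,c_n\}$,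 with $c_i=|C^{a}_{\tau_i}|+|C^{b}_{\tau_i}|$, be the multiset of the numbers of active and busy cases in those states. The reward of decision $t$ is $$r_t=-\sum_{i=0}^{n-1}c_i\,(\tau_{i+1}-\tau_i).$$ That is, the reward accumulates the negative number of cases in the system between transitions multiplied by the simulation time between transitions, and is returned every time an action (assignment) is performed. The queue of active and busy cases at the end of an episode is truncated, so that the residual cycle time cumulated at the end of an episode for cases that are not completed is summed to the total cycle time. **Cycle time.** The cycle time of a case is the time it spends in the system. The average cycle time $W$ is the total time spent in the system by all cases divided by the total number of cases $C_{\max}$.
   Formalization: The reward of the last decision t_max also accumulates the case-time from that decision up to τ_max (the truncated queue), since with T_t ending exactly at decision t_max the claimed identity is false. *)

(* Defs.v *)
From HB Require Import structures.
From mathcomp Require Import all_boot all_order all_algebra.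
From mathcomp Require Import finmap.
From mathcomp Require Import all_classical all_reals all_analysis.

Set Implicit Arguments.
Unset Strict Implicit.
Unset Printing Implicit Defensive.

Import Order.TTheory GRing.Theory Num.Theory.
Local Open Scope ring_scope.

(* Only the values of [comp_param] on [assignable] matter. *)
Record dtap (R : realType) (M L : finType) := Dtap {
  start_label : L;
  end_label : L;
  start_neq_end : start_label != end_label;
  assignable : {set L * M};
  comp_param : L * M -> R * R;
  comp_param_gt0 : forall g, g \in assignable ->
    0 < (comp_param g).1 /\ 0 < (comp_param g).2;
  trans_prob : L -> L -> R;
  trans_prob_ge0 : forall l l', 0 <= trans_prob l l';
  trans_prob_sum1 : forall l, \sum_(l' : L) trans_prob l l' = 1;
  end_reachable : exists l, 0 < trans_prob l end_label;
  calendar_size : nat;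
  calendar : calendar_size.-tuple nat;
  weight : M -> nat;
  arrival_rate : R;
  arrival_rate_gt0 : 0 < arrival_rate;
  horizon : R;
  horizon_gt0 : 0 < horizon
}.

(* Cases carry an identifier, which is needed to speak of the cycle time of a
   case.  The multiset of active (busy) cases is the finite map from the
   identifiers of these cases to their current labels.  In an assignment
   [(m, c, u)], [u] is the instant at which it completes. *)
Record state (R : realType) (M L : finType) := State {
  active_res : {set M};
  busy_res : {set M};
  active_cases : {fmap nat -> L};
  busy_cases : {fmap nat -> L};
  completed_cases : {fset nat};
  assignments : {fset M * nat * R};
  decision_step : nat
}.

(* [l] is always the current label of case [c].  In [StartActivity], [d] is the
   sampled completion time.  [CompleteCase] is the completion of an activity
   for which the sampled next label is End; [CompleteActivity] covers the other
   labels.  The flag [stay] says whether the resource becomes active again or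
   leaves the system. *)
Inductive event (R : realType) (M L : finType) :=
| CaseArrival (c : nat)
| PlanActivity (l : L) (m : M) (c : nat)
| StartActivity (l : L) (m : M) (c : nat) (d : R)
| CompleteActivity (l : L) (m : M) (c : nat) (l' : L) (stay : bool)
| CompleteCase (l : L) (m : M) (c : nat) (stay : bool)
| ScheduleResources (A : {set M}).
Arguments CaseArrival {R M L} c.
Arguments PlanActivity {R M L} l m c.
Arguments StartActivity {R M L} l m c d.
Arguments CompleteActivity {R M L} l m c l' stay.
Arguments CompleteCase {R M L} l m c stay.
Arguments ScheduleResources {R M L} A.

Definition is_plan (R : realType) (M L : finType) (e : event R M L) : bool :=
  if e is PlanActivity _ _ _ then true else false.
Definition is_start (R : realType) (M L : finType) (e : event R M L) : bool :=
  if e is StartActivity _ _ _ _ then true else false.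
Definition is_schedule (R : realType) (M L : finType) (e : event R M L)
    : bool :=
  if e is ScheduleResources _ then true else false.
Definition is_arrival (R : realType) (M L : finType) (e : event R M L) : bool :=
  if e is CaseArrival _ then true else false.
Definition is_arrival_of (R : realType) (M L : finType) (c : nat)
    (e : event R M L) : bool :=
  if e is CaseArrival c' then c' == c else false.
Definition is_completion_of (R : realType) (M L : finType) (c : nat)
    (e : event R M L) : bool :=
  if e is CompleteCase _ _ c' _ then c' == c else false.

Definition initial_state (R : realType) (M L : finType) (A : {set M})
    : state R M L :=
  State A finset.set0 fmap0 fmap0 fset0 fset0 0.

(* [step D tau s e s'] is the transition from [s] to [s'] by event [e] at
   simulated time [tau].  Random outcomes are restricted here to the support of
   their laws; the laws are in [simulation].  The way [calendar] and [weight]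
   determine the outcome of [ScheduleResources] is left free, except that a
   resource of weight 0 is never drawn. *)
Inductive step (R : realType) (M L : finType) (D : dtap R M L) (tau : R)
    : state R M L -> event R M L -> state R M L -> Prop :=
| step_arrival (Ma Mb : {set M}) (Ca Cb : {fmap nat -> L}) (Cc : {fset nat})
    (B : {fset M * nat * R}) (t : nat) (c : nat) :
    c \notin domf Ca -> c \notin domf Cb -> c \notin Cc ->
    step D tau (State Ma Mb Ca Cb Cc B t) (CaseArrival c)
      (State Ma Mb Ca.[c <- start_label D]%fmap Cb Cc B t)
| step_plan (Ma Mb : {set M}) (Ca Cb : {fmap nat -> L}) (Cc : {fset nat})
    (B : {fset M * nat * R}) (t : nat) (l : L) (m : M) (c : nat) :
    m \in Ma -> Ca.[? c]%fmap = Some l -> (l, m) \in assignable D ->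
    step D tau (State Ma Mb Ca Cb Cc B t) (PlanActivity l m c)
      (State (Ma :\ m)%SET (m |: Mb)%SET Ca.[~ c]%fmap Cb.[c <- l]%fmap Cc B
         t.+1)
| step_start (Ma Mb : {set M}) (Ca Cb : {fmap nat -> L}) (Cc : {fset nat})
    (B : {fset M * nat * R}) (t : nat) (l : L) (m : M) (c : nat) (d : R) :
    m \in Mb -> (forall b, b \in B -> b.1.1 != m) ->
    Cb.[? c]%fmap = Some l -> (forall b, b \in B -> b.1.2 != c) ->
    0 <= d ->
    step D tau (State Ma Mb Ca Cb Cc B t) (StartActivity l m c d)
      (State Ma Mb Ca Cb Cc ((m, c, tau + d)%R |` B)%fset t)
| step_complete_activity (Ma Mb : {set M}) (Ca Cb : {fmap nat -> L})
    (Cc : {fset nat}) (B : {fset M * nat * R}) (t : nat)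
    (l : L) (m : M) (c : nat) (l' : L) (stay : bool) :
    (m, c, tau) \in B -> Cb.[? c]%fmap = Some l ->
    0 < trans_prob D l l' -> l' != end_label D ->
    step D tau (State Ma Mb Ca Cb Cc B t) (CompleteActivity l m c l' stay)
      (State (if stay then (m |: Ma)%SET else Ma) (Mb :\ m)%SET
         Ca.[c <- l']%fmap Cb.[~ c]%fmap Cc (B `\ (m, c, tau))%fset t)
| step_complete_case (Ma Mb : {set M}) (Ca Cb : {fmap nat -> L})
    (Cc : {fset nat}) (B : {fset M * nat * R}) (t : nat)
    (l : L) (m : M) (c : nat) (stay : bool) :
    (m, c, tau) \in B -> Cb.[? c]%fmap = Some l ->
    0 < trans_prob D l (end_label D) ->
    step D tau (State Ma Mb Ca Cb Cc B t) (CompleteCase l m c stay)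
      (State (if stay then (m |: Ma)%SET else Ma) (Mb :\ m)%SET
         Ca Cb.[~ c]%fmap (c |` Cc)%fset (B `\ (m, c, tau))%fset t)
| step_schedule (Ma Mb : {set M}) (Ca Cb : {fmap nat -> L}) (Cc : {fset nat})
    (B : {fset M * nat * R}) (t : nat) (A : {set M}) :
    (exists k : nat, tau = k%:R) -> [disjoint A & Mb] ->
    (forall m, (m \in A) != (m \in Ma) -> (0 < weight D m)%N) ->
    step D tau (State Ma Mb Ca Cb Cc B t) (ScheduleResources A)
      (State A Mb Ca Cb Cc B t).

Definition possible_assignment (R : realType) (M L : finType) (D : dtap R M L)
    (s : state R M L) : Prop :=
  exists l m c, [/\ m \in active_res s, (active_cases s).[? c]%fmap = Some l
                  & (l, m) \in assignable D].

Definition unstarted (R : realType) (M L : finType) (s : state R M L) : Prop :=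
  exists2 m, m \in busy_res s & forall b, b \in assignments s -> b.1.1 != m.

(* Simulated time may go from [tau] to [tau'] while the state remains [s]:
   no time elapses while the agent has a decision to take, nor beyond the
   completion of an ongoing assignment. *)
Definition may_elapse (R : realType) (M L : finType) (D : dtap R M L)
    (s : state R M L) (tau tau' : R) : Prop :=
  [/\ tau <= tau',
      tau < tau' -> ~ possible_assignment D s
    & forall b, b \in assignments s -> tau' <= b.2].

Record transition (R : realType) (M L : finType) := Transition {
  tr_time : R;
  tr_event : event R M L;
  tr_state : state R M L
}.

(* A planned activity is started at once, by the very next transition. *)
Fixpoint run (R : realType) (M L : finType) (D : dtap R M L) (tau : R)
    (s : state R M L) (tr : seq (transition R M L)) : Prop :=
  if tr is x :: tr' then
    [/\ may_elapse D s tau (tr_time x),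
        unstarted s -> is_start (tr_event x) /\ tr_time x = tau,
        step D (tr_time x) s (tr_event x) (tr_state x)
      & run D (tr_time x) (tr_state x) tr']
  else may_elapse D s tau (horizon D) /\ ~ unstarted s.

Record episode (R : realType) (M L : finType) := Episode {
  ep_initial_res : {set M};
  ep_transitions : seq (transition R M L)
}.

Definition ep_initial_state (R : realType) (M L : finType) (ep : episode R M L)
    : state R M L :=
  initial_state R L (ep_initial_res ep).

Definition valid_episode (R : realType) (M L : finType) (D : dtap R M L)
    (ep : episode R M L) : Prop :=
  run D 0 (ep_initial_state ep) (ep_transitions ep) /\
  (forall k : nat, (0 < k)%N -> k%:R < horizon D ->
     count (fun x => is_schedule (tr_event x) && (tr_time x == k%:R))
       (ep_transitions ep) = 1%N).

Definition final_state (R : realType) (M L : finType) (ep : episode R M L)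
    : state R M L :=
  last (ep_initial_state ep) [seq tr_state x | x <- ep_transitions ep].

Definition n_cases (R : realType) (M L : finType) (s : state R M L) : nat :=
  (#|` domf (active_cases s)| + #|` domf (busy_cases s)|)%N.

(* Start of the simulation, then all the transitions: each entry is an instant
   with the state from that instant on. *)
Definition timeline (R : realType) (M L : finType) (ep : episode R M L)
    : seq (R * state R M L) :=
  (0, ep_initial_state ep) ::
  [seq (tr_time x, tr_state x) | x <- ep_transitions ep].

(* Position of decision number [t] in the timeline. *)
Definition decision_pos (R : realType) (M L : finType) (ep : episode R M L)
    (t : nat) : nat :=
  find (fun x => t < decision_step x.2)%N (timeline ep).

Definition n_decisions (R : realType) (M L : finType) (D : dtap R M L)
    (ep : episode R M L) : nat :=
  count (fun x => is_plan (tr_event x) && (tr_time x < horizon D))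
    (ep_transitions ep).

Definition last_decision (R : realType) (M L : finType) (D : dtap R M L)
    (ep : episode R M L) (t : nat) : Prop :=
  n_decisions D ep = t.+1.

(* The transitions from decision [t - 1] (from the start of the simulation if
   [t = 0]) to decision [t], both included.  For the last decision of the
   episode, they go on until the horizon, where the queue is truncated: the
   time spent in the system after that decision, in particular the residual
   cycle time of the cases that are not completed, is accumulated too. *)
Definition reward_window (R : realType) (M L : finType) (D : dtap R M L)
    (ep : episode R M L) (t : nat) : seq (R * state R M L) :=
  let from := if t is t'.+1 then decision_pos ep t' else 0%N in
  if t.+1 == n_decisions D ep
  then rcons (drop from (timeline ep)) (horizon D, final_state ep)
  else drop from (take (decision_pos ep t).+1 (timeline ep)).

Definition reward (R : realType) (M L : finType) (D : dtap R M L)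
    (ep : episode R M L) (t : nat) : R :=
  let w := reward_window D ep t in
  let x := nth (0, ep_initial_state ep) w in
  - \sum_(0 <= i < (size w).-1)
      (n_cases (x i).2)%:R * ((x i.+1).1 - (x i).1).

Definition discounted_return (R : realType) (M L : finType) (D : dtap R M L)
    (gamma : R) (ep : episode R M L) (tmax : nat) : R :=
  \sum_(0 <= t < tmax.+1) gamma ^+ t * reward D ep t.

(* The time of the first transition whose event satisfies [p], or the horizon
   if there is none: the residual time of a case that is not completed counts
   in its cycle time up to the horizon. *)
Definition event_time (R : realType) (M L : finType) (D : dtap R M L)
    (ep : episode R M L) (p : pred (event R M L)) : R :=
  head (horizon D) [seq tr_time x | x <- ep_transitions ep & p (tr_event x)].

Definition cycle_time (R : realType) (M L : finType) (D : dtap R M L)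
    (ep : episode R M L) (c : nat) : R :=
  event_time D ep (is_completion_of c) - event_time D ep (is_arrival_of c).

Definition Cmax (R : realType) (M L : finType) (ep : episode R M L) : nat :=
  (#|` domf (active_cases (final_state ep))| +
   #|` domf (busy_cases (final_state ep))| +
   #|` completed_cases (final_state ep)|)%N.

Definition entered_cases (R : realType) (M L : finType) (ep : episode R M L)
    : {fset nat} :=
  (domf (active_cases (final_state ep)) `|`
   domf (busy_cases (final_state ep)) `|`
   completed_cases (final_state ep))%fset.

Definition avg_cycle_time (R : realType) (M L : finType) (D : dtap R M L)
    (ep : episode R M L) : R :=
  (\sum_(c <- entered_cases ep) cycle_time D ep c) / (Cmax ep)%:R.

Definition n_arrivals (R : realType) (M L : finType) (ep : episode R M L)
    (a b : R) : nat :=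
  count (fun x => is_arrival (tr_event x) && (a < tr_time x <= b))
    (ep_transitions ep).

Definition started (R : realType) (M L : finType) (ep : episode R M L)
    : seq (L * M * R) :=
  pmap (fun x => if tr_event x is StartActivity l m _ d then Some (l, m, d)
                 else None) (ep_transitions ep).

Definition next_labels (R : realType) (M L : finType) (D : dtap R M L)
    (ep : episode R M L) : seq (L * L) :=
  pmap (fun x => match tr_event x with
                 | CompleteActivity l _ _ l' _ => Some (l, l')
                 | CompleteCase l _ _ _ => Some (l, end_label D)
                 | _ => None
                 end) (ep_transitions ep).

Local Open Scope classical_set_scope.

Definition started_at (R : realType) (M L : finType) (g : L * M) (n : nat)
    (A : set R) : set (episode R M L) :=
  [set ep | exists2 d, onth (started ep) n = Some (g, d) & A d].

Definition next_label_at (R : realType) (M L : finType) (D : dtap R M L)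
    (l : L) (n : nat) (A : set L) : set (episode R M L) :=
  [set ep | exists2 l', onth (next_labels D ep) n = Some (l, l') & A l'].

(* A random episode of the instance [D] under an arbitrary behaviour of the
   agent.  A constant arrival rate means that the expected number of arrivals
   in any time interval is [arrival_rate] times its length.  Given that the
   [n]-th started activity is the pair [g], its completion time is the absolute
   value of a Gaussian of parameters [comp_param g]; given that the [n]-th
   completed activity is [l], the next label has law [trans_prob l]. *)
Record simulation (R : realType) (M L : finType) (D : dtap R M L)
    (d : measure_display) (T : measurableType d) (Pr : probability T R)
    (X : T -> episode R M L) : Prop := Simulation {
  sim_valid : forall w, valid_episode D (X w);
  sim_arrivals_measurable : forall a b, 0 <= a -> a <= b -> b <= horizon D ->
    measurable_fun setT (fun w => (n_arrivals (X w) a b)%:R : R);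
  sim_arrival_rate : forall a b, 0 <= a -> a <= b -> b <= horizon D ->
    ('E_Pr[(fun w => (n_arrivals (X w) a b)%:R)%R] =
     (arrival_rate D * (b - a))%R%:E)%E;
  sim_completion_measurable : forall n g (A : set R), measurable A ->
    measurable (X @^-1` started_at g n A);
  sim_completion_law : forall n g (A : set R), measurable A ->
    (Pr (X @^-1` started_at g n A) =
     Pr (X @^-1` started_at g n setT) *
     normal_prob (comp_param D g).1 (comp_param D g).2
       [set x | A `|x|%R])%E;
  sim_transition_measurable : forall n l (A : set L),
    measurable (X @^-1` next_label_at D l n A);
  sim_transition_law : forall n l l',
    (Pr (X @^-1` next_label_at D l n [set l']%classic) =
     Pr (X @^-1` next_label_at D l n setT) * (trans_prob D l l')%:E)%E
}.

(* Main.v *)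
(* Both sides are the integral over [0, horizon] of the number of cases in the
   system.  The windows of consecutive decisions share an endpoint and the last
   one reaches the horizon, so the rewards add up to minus that integral.
   Writing the number of cases as a sum of indicators, one per case, and
   integrating each, a case contributes its completion time minus its arrival
   time, both cut at the horizon: an identifier is never reused, so a case
   enters once, stays until its only completion, and never comes back. *)

Require Import Defs.
From mathcomp Require Import all_boot all_order all_algebra.
From mathcomp Require Import all_classical all_reals all_analysis.
From mathcomp Require Import finmap ring.

Set Implicit Arguments.
Unset Strict Implicit.
Unset Printing Implicit Defensive.

Import Order.TTheory GRing.Theory Num.Theory.
Local Open Scope ring_scope.

(** * Status of a case across one transition *)

Definition in_system (R : realType) (M L : finType) (s : state R M L)
    (c : nat) : bool :=
  (c \in domf (active_cases s)) || (c \in domf (busy_cases s)).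

Definition has_entered (R : realType) (M L : finType) (s : state R M L)
    (c : nat) : bool :=
  in_system s c || (c \in completed_cases s).

(** Pairwise disjointness of active, busy and completed cases, so that the cardinalities in
    [n_cases] and [Cmax] count no case twice. *)
Definition well_formed (R : realType) (M L : finType) (s : state R M L)
    : Prop :=
  forall c, ~~ ((c \in domf (active_cases s)) && (c \in domf (busy_cases s)))
    && ~~ (in_system s c && (c \in completed_cases s)).

Lemma fnd_mem_domf (K : choiceType) (V : Type) (f : {fmap K -> V}) (k : K)
    (v : V) :
  f.[? k]%fmap = Some v -> k \in domf f.
Proof. by case: fndP. Qed.

Lemma step_well_formed (R : realType) (M L : finType) (D : dtap R M L)
    (tau : R) (s s' : state R M L) (e : event R M L) :
  step D tau s e s' -> well_formed s -> well_formed s'.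
Proof.
case=> {s e s'} Ma Mb Ca Cb Cc B t //.
- move=> c aN bN cN wf x; move: (wf x).
  rewrite /in_system /active_cases /busy_cases /completed_cases dom_setf !inE.
  by case: eqP => // ->; rewrite (negPf aN) (negPf bN) (negPf cN).
- move=> l m c _ Ec _ wf x; have cCa := fnd_mem_domf Ec; move: (wf x).
  rewrite /in_system /active_cases /busy_cases /completed_cases.
  rewrite domf_rem dom_setf !inE; case: eqP => //= ->.
  by rewrite cCa; case: (c \in domf Cb).
- move=> l m c l' st _ Ec _ _ wf x; have cCb := fnd_mem_domf Ec; move: (wf x).
  rewrite /in_system /active_cases /busy_cases /completed_cases.
  rewrite domf_rem dom_setf !inE; case: eqP => //= ->.
  by rewrite cCb; case: (c \in domf Ca).
- move=> l m c st _ Ec _ wf x; have cCb := fnd_mem_domf Ec; move: (wf x).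
  rewrite /in_system /active_cases /busy_cases /completed_cases.
  rewrite domf_rem !inE; case: eqP => //= ->.
  by rewrite cCb; case: (c \in domf Ca).
Qed.

(** Planning and completing only move a case between the three sets behind [has_entered], so their
    union changes at arrivals alone. *)
Lemma step_has_entered (R : realType) (M L : finType) (D : dtap R M L)
    (tau : R) (s s' : state R M L) (e : event R M L) (c : nat) :
  step D tau s e s' -> has_entered s' c = has_entered s c || is_arrival_of c e.
Proof.
rewrite /has_entered /in_system.
case=> {s e s'} Ma Mb Ca Cb Cc B t;
  rewrite /active_cases /busy_cases /completed_cases ?orbF //.
- move=> x _ _ _; rewrite dom_setf !inE /= eq_sym.
  by case: eqP => _ /=; rewrite ?orbT ?orbF.
- move=> l m x _ Ec _; have xCa := fnd_mem_domf Ec.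
  rewrite domf_rem dom_setf !inE orbF.
  by case: eqP => //= ->; rewrite xCa.
- by move=> *; rewrite orbF.
- move=> l m x l' st _ Ec _ _; have xCb := fnd_mem_domf Ec.
  rewrite domf_rem dom_setf !inE orbF.
  by case: eqP => //= ->; rewrite xCb orbT.
- move=> l m x st _ Ec _; have xCb := fnd_mem_domf Ec.
  rewrite domf_rem !inE orbF.
  by case: eqP => //= ->; rewrite xCb !orbT.
- by move=> *; rewrite orbF.
Qed.

Lemma step_completed (R : realType) (M L : finType) (D : dtap R M L)
    (tau : R) (s s' : state R M L) (e : event R M L) (c : nat) :
  step D tau s e s' -> (c \in completed_cases s') =
    (c \in completed_cases s) || is_completion_of c e.
Proof.
case=> {s e s'} Ma Mb Ca Cb Cc B t *; rewrite /= ?orbF //.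
by rewrite !inE orbC eq_sym.
Qed.

Lemma step_arrival_fresh (R : realType) (M L : finType) (D : dtap R M L)
    (tau : R) (s s' : state R M L) (e : event R M L) (c : nat) :
  step D tau s e s' -> is_arrival_of c e -> ~~ has_entered s c.
Proof.
rewrite /has_entered /in_system; case=> {s e s'} //=.
by move=> ? ? ? ? ? ? ? x aN bN cN /eqP <-; rewrite !negb_or aN bN cN.
Qed.

Lemma step_completion_in_system (R : realType) (M L : finType)
    (D : dtap R M L) (tau : R) (s s' : state R M L) (e : event R M L)
    (c : nat) :
  step D tau s e s' -> is_completion_of c e -> in_system s c.
Proof.
rewrite /in_system; case=> {s e s'} //=.
move=> ? ? ? ? ? ? ? l m x st _ Ec _ /eqP <-; have xCb := fnd_mem_domf Ec.
by rewrite xCb orbT.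
Qed.

Lemma step_decision_step (R : realType) (M L : finType) (D : dtap R M L)
    (tau : R) (s s' : state R M L) (e : event R M L) :
  step D tau s e s' -> decision_step s' = (is_plan e + decision_step s)%N.
Proof. by case. Qed.

(** * Invariants along a run *)

Lemma run_decision_step (R : realType) (M L : finType) (D : dtap R M L)
    (tr : seq (transition R M L)) (tau : R) (s : state R M L) :
  run D tau s tr -> decision_step (last s [seq tr_state x | x <- tr]) =
    (count (fun x => is_plan (tr_event x)) tr + decision_step s)%N.
Proof.
elim: tr tau s => //= x tr IH tau s [_ _ st /IH ->].
by rewrite (step_decision_step st) addnCA addnA.
Qed.

Lemma run_has_entered (R : realType) (M L : finType) (D : dtap R M L)
    (c : nat) (tr : seq (transition R M L)) (tau : R) (s : state R M L) :
  run D tau s tr -> has_entered s c ->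
  has_entered (last s [seq tr_state x | x <- tr]) c.
Proof.
elim: tr tau s => //= x tr IH tau s [_ _ st /IH H] cs; apply: H.
by rewrite (step_has_entered c st) cs.
Qed.

Lemma run_well_formed (R : realType) (M L : finType) (D : dtap R M L)
    (tr : seq (transition R M L)) (tau : R) (s : state R M L) :
  run D tau s tr -> well_formed s ->
  well_formed (last s [seq tr_state x | x <- tr]).
Proof.
elim: tr tau s => //= x tr IH tau s [_ _ st /IH H] wf; apply: H.
exact: step_well_formed st wf.
Qed.

(** * Time integral of the presence of one case *)

(* The integral of [f] from [tau] to [h] along the trajectory that starts in
   [s]; as nothing here asks times to increase, it is a signed sum. *)
Fixpoint area (R : realType) (M L : finType) (f : state R M L -> R)
    (h tau : R) (s : state R M L) (tr : seq (transition R M L)) : R :=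
  if tr is x :: tr' then
    f s * (tr_time x - tau) + area f h (tr_time x) (tr_state x) tr'
  else f s * (h - tau).

(* Generalized to runs that start in the middle of an episode: for what
   happened before, the initial time [tau] stands for the event time. *)
Lemma area_in_system (R : realType) (M L : finType) (D : dtap R M L)
    (c : nat) (tr : seq (transition R M L)) (tau : R) (s : state R M L) :
  let first p := head (horizon D) [seq tr_time x | x <- tr & p (tr_event x)] in
  run D tau s tr -> well_formed s ->
  area (fun s' => (in_system s' c)%:R) (horizon D) tau s tr =
    (if c \in completed_cases s then tau else first (is_completion_of c)) -
    (if has_entered s c then tau else first (is_arrival_of c)).
Proof.
elim: tr tau s => [|x tr IH] tau s /=.
  (* With no transition left and [h] the horizon, the value is [h - h] before entry, [h - tau] in
     the system, [tau - tau] after completion. *)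
  move=> _ /(_ c); rewrite /has_entered.
  by case: in_system; case: (c \in _) => //=; rewrite ?andbF // => _; ring.
move=> [_ _ st r] wf; rewrite IH //; last exact: step_well_formed st wf.
(* An arriving case has never entered and a completing one is in the system: these facts discard the
   impossible combinations of status and event. *)
have := step_arrival_fresh st (c := c).
have := step_completion_in_system st (c := c).
rewrite (step_completed c st).
rewrite (step_has_entered c st).
move: (wf c); rewrite /has_entered.
case: (in_system s c); case: (c \in _) => //=; rewrite ?andbF ?andbT //=;
case: is_completion_of => //=; case: is_arrival_of => //= _ H1 H2;
  first [by have := H1 isT | by have := H2 isT | ring].
Qed.

(** * Number of cases as a sum of indicators *)

Lemma card_fset_sum_mem (T : choiceType) (A E : {fset T}) :
  (A `<=` E)%fset -> #|` A| = (\sum_(c <- E) (c \in A))%N.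
Proof.
move=> AE; rewrite card_fset_sum1.
rewrite -(big_fset_incl (F := fun c => c \in A : nat) _ AE).
  by rewrite big_seq [RHS]big_seq; apply: eq_bigr => c ->.
by move=> c _ /negPf ->.
Qed.

Lemma n_cases_sum (R : realType) (M L : finType) (s : state R M L)
    (E : {fset nat}) :
  well_formed s -> (forall c, in_system s c -> c \in E) ->
  n_cases s = (\sum_(c <- E) in_system s c)%N.
Proof.
move=> wf sub; rewrite /n_cases.
rewrite !(@card_fset_sum_mem _ _ E); first last.
- by apply/fsubsetP => c cs; apply: sub; rewrite /in_system cs.
- by apply/fsubsetP => c cs; apply: sub; rewrite /in_system cs orbT.
rewrite -big_split; apply: eq_bigr => c _.
by case/andP: (wf c); rewrite /in_system; do 2!case: (c \in _).
Qed.

(** The sum commutes with the integral because one fixed [E] serves at all times: entered cases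
    remain so, hence it suffices to cover those of the last state. *)
Lemma area_n_cases (R : realType) (M L : finType) (D : dtap R M L)
    (E : {fset nat}) (tr : seq (transition R M L)) (tau : R)
    (s : state R M L) :
  run D tau s tr -> well_formed s ->
  (forall c, has_entered (last s [seq tr_state x | x <- tr]) c -> c \in E) ->
  area (fun s' => (n_cases s')%:R) (horizon D) tau s tr =
    \sum_(c <- E) area (fun s' => (in_system s' c)%:R) (horizon D) tau s tr.
Proof.
elim: tr tau s => [|x tr IH] tau s r wf sub.
  rewrite /= (@n_cases_sum _ _ _ s E wf) ?natr_sum ?big_distrl //.
  by move=> c cs; apply: sub; rewrite /has_entered cs.
rewrite /= (@n_cases_sum _ _ _ s E wf); last first.
  by move=> c cs; apply/sub/(run_has_entered r); rewrite /has_entered cs.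
case: r => _ _ st r.
by rewrite natr_sum big_distrl big_split IH //; exact: step_well_formed st wf.
Qed.

(** * Sums over consecutive windows *)

Lemma sum_nat_consecutive (V : nmodType) (b : nat -> nat) (F : nat -> V)
    (n : nat) :
  (forall t, t < n -> b t <= b t.+1)%N ->
  \sum_(0 <= t < n) \sum_(b t <= i < b t.+1) F i = \sum_(b 0%N <= i < b n) F i.
Proof.
move=> mono.
(* Gluing ranges needs ordered bounds, since a range with reversed bounds is empty rather than
   negative. *)
have le0 m : (m <= n -> b 0 <= b m)%N.
  by elim: m => // m IH mn; rewrite (leq_trans (IH (ltnW mn))) ?mono.
elim: n mono le0 => [|n IH] mono le0; first by rewrite !big_geq.
rewrite big_nat_recr //= IH => [|t tn|m mn]; last 2 first.
- by apply: mono; apply: leqW.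
- by apply: le0; apply: leqW.
by rewrite -(big_cat_nat (n := b n)) ?mono ?le0.
Qed.

Definition increment (R : realType) (M L : finType) (x0 : R * state R M L)
    (y : seq (R * state R M L)) (i : nat) : R :=
  (n_cases (nth x0 y i).2)%:R * ((nth x0 y i.+1).1 - (nth x0 y i).1).

Lemma sum_increment_window (R : realType) (M L : finType)
    (x0 : R * state R M L) (y : seq (R * state R M L)) (a b : nat) :
  (b < size y)%N ->
  let w := drop a (take b.+1 y) in
  \sum_(0 <= i < (size w).-1) increment x0 w i =
    \sum_(a <= i < b) increment x0 y i.
Proof.
move=> by_ w.
(* Entry [b] belongs to the slice as the right endpoint of its last interval, which leaves [b - a]
   increments. *)
rewrite -{1}[a]add0n big_addn size_drop size_takel // subSKn.
apply: eq_big_nat => i /andP[_ ilt]; rewrite /increment.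
rewrite !nth_drop addnS (addnC a).
have lt : (i + a < b)%N by rewrite addnC -ltn_subRL.
by rewrite !nth_take ?ltnS ?(ltnW lt).
Qed.

Lemma sum_increment_area (R : realType) (M L : finType)
    (x0 : R * state R M L) (h tau : R) (s : state R M L)
    (tr : seq (transition R M L)) :
  \sum_(0 <= i < (size tr).+1)
    increment x0 (rcons ((tau, s) :: [seq (tr_time x, tr_state x) | x <- tr])
      (h, last s [seq tr_state x | x <- tr])) i =
  area (fun s' => (n_cases s')%:R) h tau s tr.
Proof.
elim: tr tau s => [|x tr IH] tau s; first by rewrite big_nat1.
by rewrite big_nat_recl //= -IH.
Qed.

(** Index, in the timeline with a horizon entry appended, where the window of decision [t] begins
    and that of [t - 1] ends. At [t = n_decisions D ep] it points to the horizon entry. *)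
Definition window_bound (R : realType) (M L : finType) (D : dtap R M L)
    (ep : episode R M L) (t : nat) : nat :=
  if t is t'.+1 then
    if t == n_decisions D ep then size (timeline ep) else decision_pos ep t'
  else 0%N.

(** * Rewards and cycle times of a whole episode *)

Section Episode.

Variables (R : realType) (M L : finType) (D : dtap R M L) (ep : episode R M L).
Hypothesis valid : run D 0 (ep_initial_state ep) (ep_transitions ep).

Let truncated := rcons (timeline ep) (horizon D, final_state ep).
Let origin := (0 : R, ep_initial_state ep).

(** The search succeeds at the final state at the latest: its counter is the number of all plans, at
    least that of the plans before the horizon. *)
Lemma decision_pos_lt (t : nat) :
  (t < n_decisions D ep)%N -> (decision_pos ep t < size (timeline ep))%N.
Proof.
move=> tn; rewrite -has_find; apply/(has_nthP origin).
exists (size (ep_transitions ep)); first by rewrite /= size_map.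
have -> : nth origin (timeline ep) (size (ep_transitions ep)) =
    last origin (timeline ep) by rewrite -nth_last /= size_map.
have -> : (last origin (timeline ep)).2 = final_state ep.
  by rewrite /final_state /= -(last_map snd) -map_comp.
rewrite (run_decision_step valid) addn0; apply: leq_trans tn _.
by apply: sub_count => x /andP[].
Qed.

Lemma window_bound_mono (t : nat) :
  (t < n_decisions D ep -> window_bound D ep t <= window_bound D ep t.+1)%N.
Proof.
case: t => // t tn; rewrite /window_bound ltn_eqF //.
case: ifP => _; first exact: find_size.
by apply: sub_find => x /ltnW.
Qed.

Lemma reward_increment (t : nat) :
  (t < n_decisions D ep)%N ->
  reward D ep t = - \sum_(window_bound D ep t <= i < window_bound D ep t.+1)
    increment origin truncated i.
Proof.
move=> tn; rewrite /reward; congr (- _).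
have fromE : (if t is t'.+1 then decision_pos ep t' else 0%N) =
    window_bound D ep t by case: t tn => //= t /ltn_eqF ->.
rewrite -sum_increment_window; last first.
  rewrite size_rcons ltnS /window_bound; case: ifP => // _.
  exact: find_size.
have -> // : reward_window D ep t =
  drop (window_bound D ep t) (take (window_bound D ep t.+1).+1 truncated).
rewrite /reward_window fromE /truncated [window_bound D ep t.+1]/=.
(* For the last decision the slice extends to the end of [truncated]; for an earlier one it stops
   before the appended entry. *)
case: eqP => [_|].
  rewrite -(size_rcons (timeline ep) (horizon D, final_state ep)) take_size.
  by rewrite drop_rcons // -fromE; case: (t) => // u; exact: find_size.
by rewrite -cats1 takel_cat //; exact: decision_pos_lt.
Qed.

Lemma sum_reward_area :
  (0 < n_decisions D ep)%N ->
  \sum_(0 <= t < n_decisions D ep) reward D ep t =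
  - area (fun s => (n_cases s)%:R) (horizon D) 0 (ep_initial_state ep)
      (ep_transitions ep).
Proof.
move=> n0; under eq_big_nat => t /andP[_ tn] do rewrite reward_increment //.
rewrite sumrN; congr (- _).
rewrite sum_nat_consecutive; last exact: window_bound_mono.
(* With at least one decision, the last bound is the size of the timeline, so the windows cover all
   of [truncated]. *)
rewrite {2}/window_bound; case: n_decisions n0 => // n _.
by rewrite eqxx /= size_map sum_increment_area.
Qed.

Lemma initial_well_formed : well_formed (ep_initial_state ep).
Proof. by []. Qed.

Lemma sum_cycle_time :
  area (fun s => (n_cases s)%:R) (horizon D) 0 (ep_initial_state ep)
    (ep_transitions ep) =
  \sum_(c <- entered_cases ep) cycle_time D ep c.
Proof.
rewrite (area_n_cases (E := entered_cases ep) valid initial_well_formed).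
  apply: eq_bigr => c _.
  rewrite (area_in_system c valid initial_well_formed).
  (* Nothing has entered initially, so both terms are event times over the whole episode. *)
  by rewrite /has_entered /in_system.
by move=> c; rewrite /entered_cases !in_fsetU.
Qed.

Lemma Cmax_entered : Cmax ep = #|` entered_cases ep|.
Proof.
have wf : well_formed (final_state ep).
  exact: run_well_formed valid initial_well_formed.
have card_disjoint (A B : {fset nat}) :
    (forall c, ~~ ((c \in A) && (c \in B))) ->
    #|` (A `|` B)%fset| = (#|` A| + #|` B|)%N.
  move=> AB; rewrite cardfsU (_ : A `&` B = fset0)%fset ?cardfs0 ?subn0 //.
  by apply/fsetP => c; rewrite in_fsetI in_fset0; apply/negbTE.
rewrite /Cmax /entered_cases !card_disjoint // => c.
  by case/andP: (wf c).
by rewrite in_fsetU; case/andP: (wf c).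
Qed.

End Episode.

Theorem theorem1 (R : realType) (M L : finType) (D : dtap R M L)
    (d : measure_display) (T : measurableType d) (Pr : probability T R)
    (X : T -> episode R M L) (hX : simulation D Pr X)
    (gamma : R) (hgamma : gamma = 1)
    (w : T) (tmax : nat) (htmax : last_decision D (X w) tmax) :
  discounted_return D gamma (X w) tmax =
    \sum_(0 <= t < tmax.+1) reward D (X w) t /\
  \sum_(0 <= t < tmax.+1) reward D (X w) t =
    - ((Cmax (X w))%:R * avg_cycle_time D (X w)).
Proof.
split.
  by apply: eq_bigr => t _; rewrite hgamma expr1n mul1r.
have [valid _] := sim_valid hX w.
rewrite -htmax sum_reward_area ?htmax // sum_cycle_time // /avg_cycle_time.
(* With no case at all, the average is [0 / 0 = 0]. *)
have [C0|C0] := eqVneq (Cmax (X w)) 0%N; last first.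
  by rewrite mulrC divfK // pnatr_eq0.
move: C0 (C0); rewrite {1}(Cmax_entered valid) => /eqP; rewrite cardfs_eq0.
by move=> /eqP -> ->; rewrite big_seq_fset0 mul0r.
Qed.
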